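(* Let $G$ be a finite group. (1) If $G$ is simple, then $G$ is exp-simple. (2) If $G$ is solvable, then $G$ is exp-simple if and only if $G$ is a $p$-group with exponent $p$ (for some prime $p$). (3) If $G$ is the direct product of simple groups, then $G$ is exp-simple if and only if each simple direct factor of $G$ has the same exponent. (4) If $G$ is quasisimple, then $G$ is exp-simple if and only if $\exp(G) = \exp(G/Z(G))$.
   Context: All groups are finite, and $\exp(G)$ denotes the exponent of $G$. A subgroup $H \le G$ is called exponential with respect to $G$ if $x^{|G:H|} \in H$ for all $x \in G$. A subgroup $H \le G$ is called exp-trivial if either $H = G$ or $\exp(G)$ divides $|G:H|$. The group $G$ is called exp-simple if every exponential subgroup of $G$ is exp-trivial. A group $G$ is quasisimple if $G = [G,G]$ and $G/Z(G)$ is a simple group.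
   Formalization: In (2) the case ''G is trivial'' is added as an alternative to ''G is a p-group with exponent p'', because the trivial group is solvable and exp-simple but its exponent is 1, not a prime. *)

(* Defs.v *)
From mathcomp Require Import all_boot all_fingroup all_solvable.

Set Implicit Arguments.
Unset Strict Implicit.
Unset Printing Implicit Defensive.

Local Open Scope group_scope.

Definition exponential (gT : finGroupType) (G H : {group gT}) : Prop :=
  H \subset G /\ forall x, x \in G -> x ^+ #|G : H| \in H.

(* Meant for H \subset G. *)
Definition exp_trivial (gT : finGroupType) (G H : {group gT}) : Prop :=
  H :=: G \/ exponent G %| #|G : H|.

Definition exp_simple (gT : finGroupType) (G : {group gT}) : Prop :=
  forall H : {group gT}, exponential G H -> exp_trivial G H.

Definition quasisimple (gT : finGroupType) (G : {group gT}) : Prop :=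
  G :=: [~: G, G] /\ simple (G / 'Z(G)).

(* Main.v *)
Require Import Defs.
From mathcomp Require Import all_boot all_fingroup all_solvable.

(** Exponential subgroups are governed by their normal cores: if [N] is the
    core of [H] in [G] and [n = #|G : H|], then [x ^+ n] lies in [H] for every
    [x] in [G] exactly when it lies in every conjugate of [H], that is, when
    [exponent (G / N) %| n]. All four claims follow from one criterion,
    [exp_simpleP]: [G] is exp-simple iff every quotient of [G] by a proper
    normal subgroup has the full exponent of [G] (it is enough that
    [exponent G] divides it, the other divisibility being automatic).

    If quotients have full exponent, the description by cores makes every
    proper exponential subgroup exp-trivial at once. For the converse, fix a
    proper normal subgroup [N] and a prime [p]. The group [G / N] has a
    [p]-subgroup whose index is divisible by [exponent (G / N)] and has the
    same [p]-part ([exists_index_partn_exponent]); its preimage in [G] is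
    exponential and proper, so exp-simplicity makes [exponent G] divide this
    index, and the [p]-part of [exponent G] divides [exponent (G / N)].

    The claims then reduce to knowing the proper normal subgroups [N] of [G].
    For [G] simple, only [N = 1] occurs. For [G] solvable and nontrivial, some
    [N] has prime index [p], which forces [exponent G = p]; conversely a
    nontrivial quotient of a group of exponent [p] has exponent [p]. In a direct
    product of simple groups, the factors are themselves quotients, and a
    proper [N] misses some factor, which then embeds in [G / N]. In a
    quasisimple group every proper [N] is central, so that [G / 'Z(G)] is a
    quotient of [G / N]. *)

Set Implicit Arguments.
Unset Strict Implicit.
Unset Printing Implicit Defensive.

Local Open Scope group_scope.

(** * Exponents of quotients and exponential subgroups *)

Lemma exponent_quotient_dvdnP (gT : finGroupType) (G N : {group gT}) n :
  N <| G ->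
  reflect (forall x, x \in G -> x ^+ n \in N) (exponent (G / N) %| n).
Proof.
move=> nsNG; have nNG := normal_norm nsNG.
apply: (iffP exponentP) => [expn x Gx | expn _ /morphimP[x Nx Gx ->]].
  apply: coset_idr; first by rewrite groupX // (subsetP nNG).
  by rewrite morphX ?(subsetP nNG) // expn // mem_quotient.
by rewrite -morphX //= coset_id ?expn.
Qed.

(** Raising to a power commutes with conjugation, so a power map that sends [G]
    into [H] sends it into every conjugate of [H], hence into the core. *)
Lemma exponential_gcore (gT : finGroupType) (G H : {group gT}) :
  exponential G H -> exponent (G / gcore H G) %| #|G : H|.
Proof.
case=> sHG expH; apply/exponent_quotient_dvdnP; first exact: gcore_normal.
move=> x Gx; apply/bigcapP=> g Gg.
by rewrite mem_conjg conjXg expH // groupJ ?groupV.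
Qed.

(** The [p]-subgroup below is chosen inside a Sylow subgroup so that its index
    keeps only the [p]-part of the exponent, while retaining the whole
    [p']-part of the group order. *)
Lemma exists_index_partn_exponent (gT : finGroupType) (Q : {group gT}) (p : nat) :
  exists K : {group gT},
    [/\ K \subset Q, exponent Q %| #|Q : K|
      & (#|Q : K|`_p = (exponent Q)`_p)%N].
Proof.
have [P sylP] := Sylow_exists p Q.
have [sPQ pP _] := and3P sylP.
have expP : ((exponent Q)`_p %| #|P|)%N.
  by rewrite (card_Hall sylP) partn_dvd ?cardG_gt0 ?exponent_dvdn.
have p_e : p.-nat ((exponent Q)`_p)%N by exact: part_pnat.
have cardPe := divnK expP.
set k := (#|P| %/ (exponent Q)`_p)%N in cardPe.
have p_k : p.-nat k by apply: pnat_dvd pP; rewrite -cardPe dvdn_mulr.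
have k_gt0 : 0 < k by case/andP: p_k.
have k_le : logn p k <= logn p #|P|.
  by rewrite dvdn_leq_log ?cardG_gt0 // -cardPe dvdn_mulr.
have [K [sKP _ cardK]] := normal_pgroup pP (normal_refl P) k_le.
have {}cardK : #|K| = k by rewrite cardK -p_part part_pnat_id.
have sKQ := subset_trans sKP sPQ.
have idx_gt0 : 0 < #|Q : K| by [].
have idx_p : (#|Q : K|`_p = (exponent Q)`_p)%N.
  apply/eqP; rewrite -(eqn_pmul2l k_gt0) cardPe (card_Hall sylP).
  by rewrite -(Lagrange sKQ) partnM ?cardG_gt0 // cardK (part_pnat_id p_k).
have idx_p' : (#|Q : K|`_p^' = #|Q|`_p^')%N.
  rewrite -(Lagrange sKQ) partnM ?cardG_gt0 // cardK.
  by rewrite (part_p'nat (n := k)) ?mul1n ?pnatNK.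
exists K; split=> //.
rewrite -(partnC p idx_gt0) -(partnC p (exponent_gt0 Q)) idx_p idx_p'.
by rewrite dvdn_mul // partn_dvd ?cardG_gt0 ?exponent_dvdn.
Qed.

(** * The criterion for exp-simplicity *)

Lemma exp_simpleP (gT : finGroupType) (G : {group gT}) :
  exp_simple G <->
  (forall N : {group gT}, N <| G -> N \proper G ->
     exponent G %| exponent (G / N)).
Proof.
split=> [simG N nsNG prNG | expG H expH].
  have nNG := normal_norm nsNG.
  apply/dvdn_partP=> [|p _]; first exact: exponent_gt0.
  have [K [sKQ expK idxK]] := exists_index_partn_exponent (G / N) p.
  have GE : coset N @*^-1 (G / N) = G by rewrite quotientGK.
  have idxH : #|G : coset N @*^-1 K| = #|G / N : K|.
    by rewrite -index_cosetpre GE.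
  have expH : exponential G (coset N @*^-1 K).
    split=> [|x Gx]; first by rewrite -GE morphpreS.
    rewrite /= idxH (subsetP (sub_cosetpre K)) //.
    by move/exponent_quotient_dvdnP: expK => ->.
  case: (simG _ expH) => [HG | expGi].
    (* An improper preimage has index 1, which the nontrivial exponent of
       [G / N] cannot divide. *)
    move: expK; rewrite -idxH HG indexgg -trivg_exponent -subG1.
    by rewrite quotient_sub1 // (negPf (proper_subn prNG)).
  rewrite /= idxH in expGi.
  by rewrite (dvdn_trans (partn_dvd p _ expGi)) // idxK dvdn_part.
have sHG := expH.1.
have [sGH | nsGH] := boolP (G \subset H).
  by left; apply/eqP; rewrite eqEsubset sHG.
right; apply: dvdn_trans (exponential_gcore expH).
apply: expG; first exact: gcore_normal.
rewrite properE (subset_trans (gcore_sub _ _)) //=.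
by apply: contra nsGH => /subset_trans-> //; exact: gcore_sub.
Qed.

(** * Simple and solvable groups *)

Lemma simple_exp_simple (gT : finGroupType) (G : {group gT}) :
  simple G -> exp_simple G.
Proof.
case/simpleP=> _ simG; apply/exp_simpleP=> N nsNG prNG.
case: (simG N nsNG) => defN; last by rewrite defN properxx in prNG.
by rewrite defN -(exponent_isog (quotient1_isog G)).
Qed.

Lemma prime_exponent_exp_simple (gT : finGroupType) (G : {group gT}) :
  prime (exponent G) -> exp_simple G.
Proof.
move=> pr_e; apply/exp_simpleP=> N nsNG prNG.
have /(primeP pr_e).2/pred2P[e1 | -> //] := exponent_quotient G N.
have: exponent (G / N) %| 1 by rewrite e1.
rewrite -trivg_exponent -subG1 quotient_sub1 ?normal_norm //.
by rewrite (negPf (proper_subn prNG)).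
Qed.

Lemma solvable_exp_simple (gT : finGroupType) (G : {group gT}) :
  solvable G ->
  exp_simple G <->
  G :=: 1 \/ exists p : nat, [/\ prime p, p.-group G & exponent G = p].
Proof.
move=> solG; split=> [/exp_simpleP expG | [G1 | [p [pr_p _ eG]]]]; last first.
- by apply: prime_exponent_exp_simple; rewrite eG.
- by right; rewrite G1 exponent1 dvd1n.
have [-> | ntG] := eqVneq (G : {set gT}) 1; [by left | right].
have [N nsNG pr_p] := sol_prime_factor_exists solG ntG.
have prNG : N \proper G.
  rewrite properEneq normal_sub // andbT.
  by apply: contraL pr_p => /eqP->; rewrite indexgg.
have eGp : exponent G %| #|G : N|.
  rewrite (dvdn_trans (expG N nsNG prNG)) // -card_quotient ?normal_norm //.
  exact: exponent_dvdn.
have eG : exponent G = #|G : N|.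
  have /(primeP pr_p).2/pred2P[e1 | //] := eGp.
  by move: ntG; rewrite trivg_exponent e1.
exists #|G : N|; split=> //.
by rewrite -pnat_exponent eG pnat_id.
Qed.

(** * Direct products of simple groups *)

Section SimpleFactors.

Variables (gT : finGroupType) (G : {group gT}).
Variables (I : finType) (S : I -> {group gT}).
Hypothesis defG : \big[dprod/1]_(i : I) S i = G.

Lemma bigdprod_complement (i : I) :
  exists2 M : {group gT}, S i \x M = G & M <| G.
Proof.
move: defG; rewrite (bigD1 i) //= => /[dup] defGi /dprodP[[_ M _ defM] _ _ _].
rewrite defM in defGi; exists M => //.
by have [] := dprod_normal2 defGi.
Qed.

Lemma bigdprod_normal (i : I) : S i <| G.
Proof.
by have [M /dprod_normal2[]] := bigdprod_complement i.
Qed.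

Lemma exponent_bigdprod_dvdn n :
  (forall i, exponent (S i) %| n) -> exponent G %| n.
Proof.
move=> expS; move: defG.
elim/big_rec: _ (G) => [H <- | i A _ IH H]; first by rewrite exponent1 dvd1n.
move=> /[dup] defH /dprodP[[_ M _ defM] _ _ _].
rewrite defM in defH.
by rewrite -(dprod_exponent defH) dvdn_lcm expS (IH M defM).
Qed.

(** A direct factor is isomorphic to the quotient by its complement, so the
    criterion forces its exponent to be that of [G]. In the other direction, a
    factor not contained in the proper normal subgroup [N] meets it trivially
    by simplicity, so the exponent of [G / N] is a multiple of the common
    exponent of the factors. *)
Lemma simple_bigdprod_exp_simple :
  (forall i, simple (S i)) ->
  exp_simple G <-> forall i j : I, exponent (S i) = exponent (S j).
Proof.
move=> simS; split=> [/exp_simpleP expG | eqS].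
  suffices expS i : exponent (S i) = exponent G by move=> i j; rewrite !expS.
  have [M defGi nsMG] := bigdprod_complement i.
  have [_ defSM cSM tiSM] := dprodP defGi.
  have nMS : S i \subset 'N(M).
    exact: subset_trans (normal_sub (bigdprod_normal i)) (normal_norm nsMG).
  have isoS : S i \isog G / M.
    by rewrite -defSM quotientMidr quotient_isog // setIC.
  have prMG : M \proper G.
    rewrite properEneq normal_sub // andbT; apply/eqP=> defM.
    have /simpleP[ntS _] := simS i.
    case/eqP: ntS; rewrite -tiSM; apply/esym/setIidPl.
    by rewrite defM normal_sub ?bigdprod_normal.
  apply/eqP; rewrite eqn_dvd exponentS ?normal_sub ?bigdprod_normal //=.
  by rewrite (exponent_isog isoS) expG.
apply/exp_simpleP=> N nsNG prNG.
have [/forallP sSN | /forallPn[i not_sSN]] := boolP [forall i, S i \subset N].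
  case/negP: (proper_subn prNG); rewrite -(bigdprodWY defG) gen_subG.
  by apply/bigcupsP=> i _; exact: sSN.
have sSG := normal_sub (bigdprod_normal i).
have nNS := subset_trans sSG (normal_norm nsNG).
have tiNS : N :&: S i = 1.
  have nsI : N :&: S i <| S i by rewrite setIC (normalGI sSG).
  have /simpleP[_ /(_ _ nsI)[//|defI]] := simS i.
  by case/negP: not_sSN; apply/setIidPr.
have expS : exponent G %| exponent (S i).
  by apply: exponent_bigdprod_dvdn => j; rewrite (eqS j i).
apply: dvdn_trans expS _.
by rewrite (exponent_isog (quotient_isog nNS tiNS)) exponentS ?quotientS.
Qed.

End SimpleFactors.

(** * Quasisimple groups *)

(** If [N] is not central, its image in the simple group [G / 'Z(G)] is
    everything, so [G = N * 'Z(G)]; the quotient [G / N] is then abelian, and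
    [G], being perfect, lies in [N]. *)
Lemma quasisimple_proper_normal_central (gT : finGroupType)
    (G N : {group gT}) :
  quasisimple G -> N <| G -> N \proper G -> N \subset 'Z(G).
Proof.
case=> perfG /simpleP[_ simGZ] nsNG prNG.
have nZN : N \subset 'N('Z(G)).
  exact: subset_trans (normal_sub nsNG) (normal_norm (center_normal G)).
case: (simGZ (N / 'Z(G))%G (quotient_normal _ nsNG)) => [/= /eqP | /= defGZ].
  by rewrite -subG1 quotient_sub1.
case/negP: (proper_subn prNG); rewrite perfG der1_min ?normal_norm //.
have sGZN : G \subset 'Z(G) * N.
  by rewrite -quotientSK ?defGZ // normal_norm ?center_normal.
have nNZ : 'Z(G) \subset 'N(N).
  exact: subset_trans (center_sub G) (normal_norm nsNG).
apply: abelianS (quotient_abelian N (center_abelian G)).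
by rewrite quotientSK ?normal_norm // -(normC nNZ).
Qed.

Lemma quasisimple_exp_simple (gT : finGroupType) (G : {group gT}) :
  quasisimple G -> exp_simple G <-> exponent G = exponent (G / 'Z(G)).
Proof.
move=> qsG; split=> [/exp_simpleP expG | eG].
  apply/eqP; rewrite eqn_dvd exponent_quotient expG ?center_normal //.
  rewrite properEneq center_sub andbT; apply/eqP=> ZG.
  have [_ /simpleP[/eqP ntGZ _]] := qsG.
  by apply: ntGZ; rewrite /= quotientS1 ?ZG.
apply/exp_simpleP=> N nsNG prNG; rewrite eG.
have sNZ := quasisimple_proper_normal_central qsG nsNG prNG.
apply/exponent_quotient_dvdnP=> [|x Gx]; first exact: center_normal.
apply: (subsetP sNZ).
exact: (exponent_quotient_dvdnP _ nsNG (dvdnn _)).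
Qed.

Theorem corollary1p4 (gT : finGroupType) (G : {group gT}) :
  [/\ simple G -> exp_simple G,
      solvable G ->
        (exp_simple G <->
         G :=: 1 \/ exists p : nat, [/\ prime p, p.-group G & exponent G = p]),
      forall (I : finType) (S : I -> {group gT}),
        \big[dprod/1]_(i : I) S i = G -> (forall i : I, simple (S i)) ->
        (exp_simple G <-> forall i j : I, exponent (S i) = exponent (S j))
    & quasisimple G ->
        (exp_simple G <-> exponent G = exponent (G / 'Z(G)))].
Proof.
split.
- exact: simple_exp_simple.
- exact: solvable_exp_simple.
- by move=> I S; exact: simple_bigdprod_exp_simple.
- exact: quasisimple_exp_simple.
Qed.
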